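(* There exists an absolute constant $K>0$ such that for every $n \ge 1$ and every graph $G$ on $n$ vertices with maximum degree $\Delta$, $$\operatorname{la}(G) \le \frac{\Delta}{2} + K\log n .$$
   Context: Graphs are finite and simple. A linear forest is a collection of vertex-disjoint paths (a single vertex counts as a path). The linear arboricity $\operatorname{la}(G)$ of a graph $G$ is the minimum number of linear forests (subgraphs of $G$) into which the edge set of $G$ can be partitioned. $\log$ is the natural logarithm. *)

(* Defs.v *)
From HB Require Import structures.
From mathcomp Require Import all_boot all_order all_algebra.
From mathcomp Require Import boolp.

Set Implicit Arguments.
Unset Strict Implicit.
Unset Printing Implicit Defensive.

Record sgraph := SGraph {
  vertex :> finType;
  adj : rel vertex;
  adj_sym : symmetric adj;
  adj_irrefl : irreflexive adj
}.

Definition edges (G : sgraph) : {set {set G}} :=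
  [set [set x; y] | x in G, y in G & adj x y].

Definition max_degree (G : sgraph) : nat :=
  \max_(x : G) #|[set y | adj x y]|.

Section LinearForest.
Variable T : finType.

Definition path_edges (p : seq T) : {set {set T}} :=
  [set e in [seq [set xy.1; xy.2] | xy <- zip p (behead p)]].

(* A linear forest is represented by its edge set.  A path is the non-empty
   sequence of its vertices in order; [uniq (flatten ps)] says both that the
   vertices of each path are distinct and that the paths are disjoint. *)
Definition linear_forest (F : {set {set T}}) : Prop :=
  exists ps : seq (seq T),
    [/\ [::] \notin ps,
        uniq (flatten ps)
      & F = \bigcup_(p <- ps) path_edges p].

Lemma linear_forest_edge (x y : T) : x != y -> linear_forest [set [set x; y]].
Proof.
move=> xy; exists [:: [:: x; y]]; split=> //=.
  by rewrite inE andbT.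
rewrite big_seq1; apply/setP => e.
by rewrite /path_edges !inE.
Qed.

End LinearForest.

Definition linear_forest_partition (G : sgraph) (P : {set {set {set G}}}) :
  Prop :=
  partition P (edges G) /\ forall F, F \in P -> linear_forest F.

Lemma linear_forest_partition_exists (G : sgraph) :
  exists k, `[< exists P : {set {set {set G}}},
                  linear_forest_partition P /\ #|P| = k >].
Proof.
exists #|[set [set e] | e in edges G]|; apply/asboolP.
exists [set [set e] | e in edges G]; split=> //; split.
  apply/and3P; split.
  - apply/eqP/setP => e; apply/bigcupP/idP => [[_ /imsetP[f fE ->]]|eE].
      by rewrite inE => /eqP ->.
    by exists [set e]; rewrite ?set11 // imset_f.
  - apply/trivIsetP => _ _ /imsetP[e _ ->] /imsetP[f _ ->] ef.
    by rewrite disjoints1 inE; apply: contraNN ef => /eqP ->.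
  - apply/negP => /imsetP[e _ /setP/(_ e)].
    by rewrite set11 inE.
move=> _ /imsetP[_ /imset2P[x y _ yx ->] ->].
apply: linear_forest_edge; apply/eqP => xy.
by move: yx; rewrite xy inE adj_irrefl andbF.
Qed.

Definition linear_arboricity (G : sgraph) : nat :=
  ex_minn (linear_forest_partition_exists G).

(* Main.v *)
Require Import Defs.
From mathcomp Require Import all_boot all_order all_algebra.
From mathcomp Require Import reals exp.
From mathcomp Require Import boolp zify.

(* Let F be a linear forest with as many edges as possible and put walkers on
   ends of its paths.  A walker at the end u may move along an edge uy of the
   graph, deleting an F-edge ys such that F + uy - ys is again a linear forest;
   it then stands at s.  If y is adjacent to a walker, one of its F-edges can be
   deleted in this way; if it is adjacent to two of them, both can.  So let U be
   the set of vertices that the walkers reach, and call y half if just one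
   F-neighbour of y is in U: then y never sees two walkers.  In an r-regular
   graph, counting the edges at U together with the F-edges at U shows that a
   large number of walkers forces the half vertices to be adjacent to so many
   vertices of U that a typical state would contradict this.

   To compare typical states with averages over U, choose F and the walkers
   maximizing r a - 12 |U|, where a is the number of walkers.  After b walkers
   have been frozen, the other ones still reach all but r b / 12 vertices of U,
   wherever the frozen ones stand; hence walkers can be placed greedily, with a
   gain at least proportional to the average one.  The outcome is
   r a <= 12 |U| + 2 sum_v (deg v - r)^+ for all graphs in which the vertices of
   U have degree at least r.

   Minimizing, in lexicographic order, the number of ends on vertices of degree
   at least 0, 1, 2, ... keeps the walkers on vertices of degree at least r
   within this set.  This gives a linear forest F such that, for all r, at most
   (12 / r) sum_v (deg v + 1 - r)^+ vertices of degree at least r have degree at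
   most 1 in F.  Removing such forests Delta / 2 times, the potential
   sum_v 2^(deg v) grows, relatively to 2^Delta, by a factor 1 + O(1 / Delta) in
   each step, hence by a power of n altogether, so that the remaining graph has
   maximum degree O(log n). *)

Set Implicit Arguments.
Unset Strict Implicit.
Unset Printing Implicit Defensive.

(** * Subgraphs as edge sets *)

Section Links.
Variable T : finType.
Implicit Types (E F : {set {set T}}) (u v x y s : T).

Lemma eq_set2 u v x y :
  ([set u; v] == [set x; y]) =
  (u == x) && (v == y) || (u == y) && (v == x).
Proof.
apply/eqP/idP => [E|/orP[]/andP[/eqP-> /eqP->] //]; last by rewrite setUC.
have := set21 u v; rewrite E !inE => /orP[]/eqP ux; subst u.
- have := set22 x v; rewrite E !inE eqxx /= => /orP[]/eqP vx; subst v; last by rewrite eqxx.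
  by have := set22 x y; rewrite -E !inE orbb => /eqP->; rewrite eqxx.
- have := set22 y v; rewrite E !inE eqxx /= => /orP[]/eqP vx; subst v; first by rewrite eqxx orbT.
  by have := set21 x y; rewrite -E !inE orbb => /eqP->; rewrite eqxx.
Qed.

(** [F] is an arbitrary family of sets, so singletons [[set u; u]] have to be discarded. *)
Definition link F : rel T := fun u v => (u != v) && ([set u; v] \in F).

Lemma link_sym F : symmetric (link F).
Proof. by move=> u v; rewrite /link eq_sym setUC. Qed.

Lemma link_connect_sym F : connect_sym (link F).
Proof. exact: sym_connect_sym (@link_sym F). Qed.

Lemma linkS E F u v : F \subset E -> link F u v -> link E u v.
Proof. by move=> /subsetP FE /andP[uv /FE uvE]; apply/andP. Qed.

Lemma connect_sub_link E F u v :
  F \subset E -> connect (link F) u v -> connect (link E) u v.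
Proof.
by move=> FE; apply: connect_sub => x y xy; apply/connect1/(linkS FE).
Qed.

Lemma linkD1 F x y u v :
  link (F :\ [set x; y]) u v = link F u v && ([set u; v] != [set x; y]).
Proof. by rewrite /link !inE [(_ != [set x; y]) && _]andbC andbA. Qed.

Lemma linkU1 F x y u v : x != y ->
  link ([set x; y] |: F) u v = link F u v || ([set u; v] == [set x; y]).
Proof.
move=> xy; rewrite /link !inE; case: (eqVneq u v) => [->|uv] /=; last exact: orbC.
by apply/esym; rewrite eq_set2; apply: contraNF xy => /orP[]/andP[/eqP-> /eqP->].
Qed.

Definition nbh F v := [set u | link F v u].
Definition deg F v := #|nbh F v|.

Lemma degD1 F x y v : link F x y ->
  deg (F :\ [set x; y]) v + (v == x) + (v == y) = deg F v.
Proof.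
move=> xy; have xNy : x != y by case/andP: xy.
have [vx|vNx] := eqVneq v x.
  subst v; rewrite (negPf xNy) addn0 addn1 /deg (cardsD1 y (nbh F x)) inE xy.
  congr _.+1; apply: eq_card => u; rewrite !inE linkD1 eq_set2 eqxx (negPf xNy) /= orbF.
  by rewrite andbC.
have [vy|vNy] := eqVneq v y.
  subst v; rewrite addn0 addn1 /deg (cardsD1 x (nbh F y)) inE link_sym xy.
  congr _.+1; apply: eq_card => u; rewrite !inE linkD1 eq_set2 eqxx (negPf vNx) /=.
  by rewrite andbC.
rewrite !addn0; apply: eq_card => u; rewrite !inE linkD1 eq_set2.
by rewrite (negPf vNx) (negPf vNy) andbT.
Qed.

Lemma degU1 F x y v : x != y -> ~~ link F x y ->
  deg ([set x; y] |: F) v = deg F v + (v == x) + (v == y).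
Proof.
move=> xy nxy; have xyF : [set x; y] \notin F by move: nxy; rewrite /link xy.
rewrite -(@degD1 ([set x; y] |: F) x y v); last by rewrite linkU1 // eqxx orbT.
by rewrite setU1K.
Qed.

Lemma deg_sub E F v : F \subset E -> deg F v <= deg E v.
Proof.
by move=> FE; apply/subset_leq_card/subsetP => u; rewrite !inE; apply: linkS.
Qed.

Lemma connectU1 F x y u v : x != y -> connect (link ([set x; y] |: F)) u v ->
  [|| connect (link F) u v,
      connect (link F) u x && connect (link F) y v |
      connect (link F) u y && connect (link F) x v].
Proof.
move=> xy /connectP[p]; elim: p u => [|w p IHp] u /=; first by move=> _ ->; rewrite connect0.
rewrite linkU1 // => /andP[uw /IHp{}IHp] /IHp{IHp}.
case/orP: uw => [/connect1 uw|].
  case/or3P => [wv|/andP[wx yv]|/andP[wy xv]].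
  - by rewrite (connect_trans uw wv).
  - by rewrite (connect_trans uw wx) yv orbT.
  - by rewrite (connect_trans uw wy) xv !orbT.
rewrite eq_set2 => /orP[]/andP[/eqP-> /eqP->]; rewrite !connect0 /=.
  by case/or3P => [->|/andP[_ ->]|->]; rewrite ?orbT.
by case/or3P => [->|->|/andP[_ ->]]; rewrite ?orbT.
Qed.

(** On a path without repetition only the last step touches [v], so the rest survives the deletion
    of that edge. *)
Lemma connect_last F u v : u != v -> connect (link F) u v ->
  exists2 s, link F s v & connect (link (F :\ [set s; v])) u s.
Proof.
move=> uv /connectP[p0 path_p0 lastv].
case/shortenP: path_p0 lastv => p; case/lastP: p => [|p w] /=.
  by move=> _ _ _ E; rewrite E eqxx in uv.
rewrite last_rcons rcons_path => /andP[up lw] /andP[]; rewrite mem_rcons inE negb_or.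
move=> /andP[uw unp]; rewrite rcons_uniq => /andP[wp _] _ E; subst w.
exists (last u p) => //; apply/connectP; exists p => //.
have : v \notin u :: p by rewrite inE negb_or eq_sym uv.
move: (last u p) => s {uv lw unp uw wp}.
elim: p u up => //= w p IHp u /andP[uw /IHp{}IHp].
rewrite !inE !negb_or => /and3P[vu vw vp].
rewrite linkD1 uw IHp ?inE ?negb_or ?vw // andbT eq_set2 negb_or !negb_and.
by rewrite [u == v]eq_sym vu [w == v]eq_sym vw !orbT.
Qed.

(** Induction on the number of edges: once the only edge [aa'] at [a] is stripped, [a'] has degree
    at most one and replaces [a]. *)
Lemma three_ends F a b c : (forall v, deg F v <= 2) ->
  deg F a <= 1 -> deg F b <= 1 -> deg F c <= 1 -> a != b -> a != c -> b != c ->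
  connect (link F) a b -> connect (link F) a c -> False.
Proof.
have [n] := ubnP #|F|; elim: n => // n IHn in F a b c *.
move=> Fn F2 da db dc ab ac bc cab cac.
have [a' a'a caa'] : exists2 a', link F a a' & connect (link (F :\ [set a; a'])) b a'.
  rewrite link_connect_sym in cab; rewrite eq_sym in ab.
  by have [s sa bs] := connect_last ab cab; exists s; rewrite 1?link_sym // setUC.
have [a'' a''a caa''] : exists2 a', link F a a' & connect (link (F :\ [set a; a'])) c a'.
  rewrite link_connect_sym in cac; rewrite eq_sym in ac.
  by have [s sa bs] := connect_last ac cac; exists s; rewrite 1?link_sym // setUC.
have E : a'' = a'.
  by apply: (card_le1_eqP da); rewrite inE.
subst a'' => {a''a}.
have aa' : a != a' by case/andP: a'a.
set F' := F :\ _ in caa' caa''.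
have dF v : deg F' v + (v == a) + (v == a') = deg F v by rewrite degD1.
have F'n : #|F'| < n.
  have : [set a; a'] \in F by case/andP: a'a.
  by move=> H; move: Fn; rewrite (cardsD1 [set a; a']) H.
have F'2 v : deg F' v <= 2 by apply: leq_trans (deg_sub v (subD1set _ _)) (F2 v).
have d' x : x != a' -> x != a -> deg F' x = deg F x.
  by move=> /negPf xa' /negPf xa; rewrite -dF xa xa' !addn0.
have isol x y : x != y -> deg F' x = 0 -> ~~ connect (link F') y x.
  move=> xy dx; apply/negP => cyx; rewrite eq_sym in xy.
  have [s sx _] := connect_last xy cyx.
  by move/eqP: dx; rewrite cards_eq0 => /eqP/setP/(_ s); rewrite !inE link_sym sx.
have zero x : x != a -> deg F x <= 1 -> x == a' -> deg F' x = 0.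
  move=> /negPf xa dx xa'; move: dx.
  by rewrite -dF xa xa' addn0 addn1 ltnS leqn0 => /eqP.
(* If [b] is [a'], it has become isolated and cannot be connected to [c]. *)
have [ba'|ba'] := eqVneq b a'.
  have := isol b c bc; rewrite zero ?ba' 1?eq_sym // -?ba' // => /(_ erefl).
  by rewrite ba' caa''.
have [ca'|ca'] := eqVneq c a'.
  have cb : c != b by rewrite eq_sym.
  have := isol c b cb; rewrite zero ?ca' 1?eq_sym // -?ca' // => /(_ erefl).
  by rewrite ca' caa'.
apply: (IHn F' a' b c) => //; rewrite 1?eq_sym //.
- have := F2 a'; rewrite -dF eqxx addn1 ltnS.
  exact/leq_trans/leq_addr.
- by rewrite d' // eq_sym.
- by rewrite d' // eq_sym.
- by rewrite link_connect_sym.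
- by rewrite link_connect_sym.
Qed.

(** By handshaking, twice the number of edges. *)
Definition volume F := \sum_v deg F v.

(* Linear forests, as subgraphs of maximum degree two all of whose edges are
   bridges. *)
Definition lforest E F := [/\ F \subset E, forall v, deg F v <= 2 &
  forall u v, link F u v -> ~~ connect (link (F :\ [set u; v])) u v].

Lemma lforest0 E : lforest E set0.
Proof.
by split; [exact: sub0set|move=> v; rewrite /deg eq_card0 // => u|move=> u v];
  rewrite ?inE /link inE andbF.
Qed.

Lemma lforestD1 E F e : lforest E F -> lforest E (F :\ e).
Proof.
move=> [FE F2 br]; have sF : F :\ e \subset F by apply: subD1set.
split; first exact: subset_trans sF FE.
- by move=> v; apply: leq_trans (deg_sub v sF) (F2 v).
- move=> u v uv; apply: contra (br u v (linkS sF uv)).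
  by apply: connect_sub_link; apply: setSD.
Qed.

Lemma lforestU1 E F u v : lforest E F -> link E u v -> deg F u <= 1 -> deg F v <= 1 ->
  ~~ connect (link F) u v -> lforest E ([set u; v] |: F).
Proof.
move=> [FE F2 br] /andP[uv uvE] du dv nuv.
have nl : ~~ link F u v by apply: contra nuv; apply: connect1.
split; first by rewrite subUset sub1set uvE.
  move=> x; rewrite degU1 //; have := F2 x.
  have [->|_] := eqVneq x u; first by rewrite (negPf uv); lia.
  by have [->|_] := eqVneq x v; lia.
move=> x y; rewrite linkU1 // => /orP[xy|/eqP exy]; last first.
  rewrite exy setU1K; last by move: nl; rewrite /link uv.
  move/eqP: exy; rewrite eq_set2 => /orP[]/andP[/eqP-> /eqP->] //.
  by rewrite link_connect_sym.
have exy : [set u; v] != [set x; y].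
  apply: contra nl => /eqP euv; move: xy; rewrite /link uv euv => /andP[_ ->].
  by [].
have -> : ([set u; v] |: F) :\ [set x; y] = [set u; v] |: (F :\ [set x; y]).
  by apply/setP => e; rewrite !inE; case: (eqVneq e [set u; v]) => [->|]; rewrite ?exy ?andbF /= ?orbF.
(* A connection through the new edge would, together with [xy], connect [u] to [v] inside [F]. *)
apply/negP => /(connectU1 uv)/or3P[|/andP[xu vy]|/andP[xv uy]].
- by apply/negP; apply: br.
- move/negP: nuv; apply.
  have S := subD1set F [set x; y].
  rewrite link_connect_sym in xu; rewrite link_connect_sym in vy.
  by apply: connect_trans (connect_sub_link S xu) (connect_trans (connect1 xy) (connect_sub_link S vy)).
- move/negP: nuv; apply.
  have S := subD1set F [set x; y]; rewrite link_sym in xy.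
  by apply: connect_trans (connect_sub_link S uy) (connect_trans (connect1 xy) (connect_sub_link S xv)).
Qed.

End Links.

(** * Rotations *)

Section Rotations.
Variables (T : finType) (E : {set {set T}}).
Implicit Types (F : {set {set T}}) (u v w x y s : T) (A B : {ffun T -> nat}).

Definition add_walkers A B : {ffun T -> nat} := [ffun v => A v + B v].
Definition walker v : {ffun T -> nat} := [ffun x => (x == v : nat)].
Definition remove_walker A v : {ffun T -> nat} := [ffun x => A x - (x == v)].

(* The function [A] of a state [(F, A)] gives the number of walkers at each
   vertex; an isolated vertex of [F] is twice an end of its path and may carry
   two walkers. *)
Notation state := ({set {set T}} * {ffun T -> nat})%type.
Implicit Types (p q : state).

(** The balance of walkers is additive to avoid truncated subtraction; [s] differs from [u] since
    [ys] is an edge of the forest and [uy] is not. *)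
Definition rotation p q := exists u y s,
  [/\ 0 < p.2 u, link E u y, ~~ link p.1 u y & link p.1 y s] /\
  [/\ q.1 = [set u; y] |: (p.1 :\ [set y; s]), lforest E q.1 &
      forall v, q.2 v + (v == u) = p.2 v + (v == s)].

Inductive reach : state -> state -> Prop :=
| reach0 p : reach p p
| reachS p q r : rotation p q -> reach q r -> reach p r.

Lemma reach_trans p q r : reach p q -> reach q r -> reach p r.
Proof. by elim=> // p1 q1 r1 st _ IH /IH; apply: reachS. Qed.

(** [u] trades a walker for a forest edge, [s] does the reverse, and the pivot [y] trades one edge
    for another. *)
Lemma rotation_deg p q v : rotation p q -> q.2 v + deg q.1 v = p.2 v + deg p.1 v.
Proof.
case=> u [y [s [[_ uyE nuy ys] [-> _ /(_ v)]]]].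
have uy : u != y by case/andP: uyE.
have nl : ~~ link (p.1 :\ [set y; s]) u y.
  by rewrite linkD1 (negPf nuy).
by have := degD1 v ys; rewrite degU1 //; lia.
Qed.

Lemma reach_deg p q v : reach p q -> q.2 v + deg q.1 v = p.2 v + deg p.1 v.
Proof. by elim=> // p1 q1 r1 /(rotation_deg v) st _ ->. Qed.

Lemma sum_eq1 u : \sum_v (v == u : nat) = 1.
Proof. by rewrite (bigD1 u) //= eqxx big1 // => v /negPf->. Qed.

Definition walkers A := \sum_v A v.

Lemma rotation_walkers p q : rotation p q -> walkers q.2 = walkers p.2.
Proof.
case=> u [y [s [_ [_ _ e]]]]; apply/eqP; rewrite -(eqn_add2r 1).
rewrite -{1}(sum_eq1 u) -(sum_eq1 s) -!big_split /=.
by apply/eqP/eq_bigr.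
Qed.

Lemma reach_walkers p q : reach p q -> walkers q.2 = walkers p.2.
Proof. by elim=> // p1 q1 r1 /rotation_walkers<- _ ->. Qed.

(** The second clause lets walkers stand only on free ends of paths. *)
Definition admissible p := [/\ lforest E p.1, forall v, p.2 v + deg p.1 v <= 2 &
  forall F, lforest E F -> volume F <= volume p.1].

Lemma reach_admissible p q : reach p q -> admissible p -> admissible q.
Proof.
elim=> // {p q} p q r pq _ IH [lfp dp mp]; apply: IH; split.
- by case: pq => u [y [s [_ []]]].
- by move=> v; rewrite (rotation_deg v pq).
(* Walkers plus volume is invariant, and so is the number of walkers; hence the volume stays
   maximal. *)
- move=> F /mp/leq_trans; apply; rewrite -(leq_add2l (walkers p.2)).
  rewrite -{2}(rotation_walkers pq) /walkers /volume -!big_split /=.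
  by apply: leq_sum => v _; rewrite (rotation_deg v pq).
Qed.

Definition reached p := [set v | `[< exists2 q, reach p q & 0 < q.2 v >]].
Notation U := reached.

Lemma reachedP p v : reflect (exists2 q, reach p q & 0 < q.2 v) (v \in U p).
Proof. by rewrite inE; apply: asboolP. Qed.

Lemma reached_self p v : 0 < p.2 v -> v \in U p.
Proof. by move=> h; apply/reachedP; exists p => //; apply: reach0. Qed.

Lemma reachedS p q : reach p q -> U q \subset U p.
Proof.
move=> pq; apply/subsetP => v /reachedP[r qr h]; apply/reachedP; exists r => //.
exact: reach_trans pq qr.
Qed.

(** Other walkers do not interfere: a rotation depends on the forest and on the moving walker
    alone. *)
Lemma reach_add p q B : reach p q ->
  reach (p.1, add_walkers p.2 B) (q.1, add_walkers q.2 B).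
Proof.
elim=> [r|{p q} p q r st _]; first exact: reach0.
apply: reachS; case: st => u [y [s [[h1 h2 h3 h4] [h5 h6 h7]]]].
exists u, y, s; split; split=> //=; first by rewrite ffunE ltn_addr.
by move=> v; rewrite !ffunE; move: (h7 v) => /=; lia.
Qed.

Lemma reached_add F A B : U (F, A) \subset U (F, add_walkers A B).
Proof.
apply/subsetP => v /reachedP[[F' A'] r h]; apply/reachedP.
by exists (F', add_walkers A' B); [apply: (reach_add B r)|rewrite ffunE ltn_addr].
Qed.

Lemma admissible_deg p u : admissible p -> 0 < p.2 u -> deg p.1 u <= 1.
Proof. by case=> _ /(_ u); lia. Qed.

(** Otherwise [uv] could be added to the forest, against its maximality. *)
Lemma admissible_deg2 p u v : admissible p -> 0 < p.2 u -> link E u v ->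
  ~~ connect (link p.1) u v -> deg p.1 v = 2.
Proof.
move=> okp pu uv nc; have [lfp _ mp] := okp; have [_ /(_ v) d2 _] := lfp.
apply/eqP; rewrite eqn_leq d2 ltnNge; apply/negP => dv.
have /mp := lforestU1 lfp uv (admissible_deg okp pu) dv nc.
have unv : u != v by case/andP: uv.
have nl : ~~ link p.1 u v by apply: contra nc; apply: connect1.
suff -> : volume ([set u; v] |: p.1) = volume p.1 + 2 by rewrite addn2 ltnNge leqnSn.
rewrite /volume (eq_bigr _ (fun x _ => degU1 x unv nl)) !big_split /= !sum_eq1.
by rewrite -addnA.
Qed.

(** Deleting [vs] makes room for [uv], and the walker at [u] moves to [s]. *)
Lemma admissible_free p u v s : admissible p -> 0 < p.2 u -> link E u v -> link p.1 v s ->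
  ~~ connect (link (p.1 :\ [set v; s])) u v -> s \in U p.
Proof.
move=> okp pu uv vs nc; have [lfp _ _] := okp; have [_ d2 _] := lfp.
have [->|us] := eqVneq s u; first exact: reached_self.
have unv : u != v by case/andP: uv.
apply/reachedP.
exists ([set u; v] |: (p.1 :\ [set v; s]), [ffun x => p.2 x + (x == s) - (x == u)]); last first.
  by rewrite ffunE eqxx /= (negPf us); lia.
apply: (reachS _ (reach0 _)); exists u, v, s; split; split=> //=.
- apply: contra nc => uvl; apply: connect1; rewrite linkD1 uvl eq_set2 negb_or !negb_and.
  by rewrite unv [u == s]eq_sym us.
- apply: lforestU1 => //; first exact: lforestD1.
  + exact: leq_trans (deg_sub _ (subD1set _ _)) (admissible_deg okp pu).
  + by move: (degD1 v vs) (d2 v); rewrite eqxx; lia.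
- by move=> x; rewrite ffunE; have [->|] := eqVneq x u; lia.
Qed.

(** A vertex is a candidate for a pivot when an edge of the graph joins it to a walker. *)
Definition seen p v := [exists u, link E u v && (0 < p.2 u)].

(** If [v] lies on the path of [u], delete the edge by which that path enters [v]: it is a bridge.
    Otherwise any edge at [v] will do. *)
Lemma seen_free p v : admissible p -> seen p v -> exists2 s, link p.1 v s & s \in U p.
Proof.
move=> okp /existsP[u /andP[uv pu]]; have [lfp _ _] := okp; have [_ _ br] := lfp.
have unv : u != v by case/andP: uv.
have [c|nc] := boolP (connect (link p.1) u v).
  have [s sv us] := connect_last unv c; rewrite setUC in us.
  exists s; first by rewrite link_sym.
  apply: admissible_free okp pu uv _ _; first by rewrite link_sym.
  apply/negP => uv'; have /negP := br _ _ sv; apply; rewrite setUC.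
  by rewrite link_connect_sym in us; apply: connect_trans us uv'.
have : 0 < deg p.1 v by rewrite (admissible_deg2 okp pu uv nc).
case/card_gt0P => s; rewrite inE => vs; exists s => //.
apply: admissible_free okp pu uv vs _; apply: contra nc.
by apply/connect_sub_link/subD1set.
Qed.

Lemma seen_twice p u u' v : admissible p -> u != u' -> link E u v -> link E u' v ->
  0 < p.2 u -> 0 < p.2 u' -> deg p.1 v = 2 /\ nbh p.1 v \subset U p.
Proof.
move=> okp uu' uv u'v pu pu'; have [[_ d2 _] _ _] := okp.
have unv : u != v by case/andP: uv.
have u'nv : u' != v by case/andP: u'v.
(* Otherwise one component would contain the three ends [u], [u'] and [v]. This is used for the
   forest itself and after deleting one edge at [v]. *)
have key F : F \subset p.1 -> deg F v <= 1 ->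
    ~~ connect (link F) u v \/ ~~ connect (link F) u' v.
  move=> Fp dv; have [c|c] := boolP (connect (link F) u v); last by left.
  have [c'|c'] := boolP (connect (link F) u' v); last by right.
  have d w : 0 < p.2 w -> deg F w <= 1.
    by move=> h; apply: leq_trans (deg_sub w Fp) (admissible_deg okp h).
  rewrite link_connect_sym in c; rewrite link_connect_sym in c'; exfalso.
  apply: three_ends dv (d _ pu) (d _ pu') _ _ uu' c c'; rewrite 1?eq_sym //.
  by move=> w; apply: leq_trans (deg_sub w Fp) (d2 w).
split.
  apply/eqP; rewrite eqn_leq d2 ltnNge; apply/negP => dv.
  by case: (key _ (subxx _) dv) => [/(admissible_deg2 okp pu uv)|/(admissible_deg2 okp pu' u'v)] e;
    rewrite e in dv.
apply/subsetP => s; rewrite inE => vs.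
have dv : deg (p.1 :\ [set v; s]) v <= 1.
  by move: (degD1 v vs) (d2 v); rewrite eqxx; lia.
by case: (key _ (subD1set _ _) dv) => nc;
  [apply: admissible_free okp pu uv vs nc|apply: admissible_free okp pu' u'v vs nc].
Qed.

(* Outside the set of vertices reached by walkers, the end that is freed at a
   pivot is replaced by the vertex of the walker. *)
Lemma reach_nbh (W : {set T}) p q v : reach p q -> U p \subset W -> v \notin W ->
  #|nbh q.1 v :&: W| = #|nbh p.1 v :&: W|.
Proof.
elim=> // {p q} p q r pq qr IH UW vW.
have pq' : reach p q by apply: reachS pq (reach0 _).
rewrite IH //; last by apply: subset_trans UW; apply: reachedS.
case: pq => u [y [s [[pu uy nuy ys] [q1 _ q2]]]].
have uW : u \in W by apply/(subsetP UW)/reached_self.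
have unys : s != u by apply: contraNneq nuy => <-; rewrite link_sym.
have sW : s \in W.
  apply/(subsetP UW)/(subsetP (reachedS pq'))/reached_self.
  by move: (q2 s); rewrite eqxx (negPf unys); lia.
have uny : u != y by case/andP: uy.
have vu : v != u by apply: contraNneq vW => ->.
have vs : v != s by apply: contraNneq vW => ->.
have nbq x : link q.1 v x = link p.1 v x && ~~ ((v == y) && (x == s)) || (v == y) && (x == u).
  by rewrite q1 linkU1 // linkD1 !eq_set2 (negPf vu) (negPf vs) /= !orbF.
have [vy|vny] := eqVneq v y; last first.
  by apply: eq_card => x; rewrite !inE nbq (negPf vny) andbT orbF.
subst v; rewrite (cardsD1 s (nbh p.1 y :&: W)) (cardsD1 u (nbh q.1 y :&: W)) !inE sW uW ys.
rewrite nbq !eqxx orbT /=; congr _.+1; apply: eq_card => x; rewrite !inE nbq eqxx /=.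
have [->|xu] := eqVneq x u; first by rewrite link_sym (negPf nuy) !andbF.
by rewrite orbF /=; case: (x != s); rewrite ?andbT ?andbF.
Qed.

End Rotations.

(** * Density of walkers *)

Lemma exchange_nbh (T : finType) (F : {set {set T}}) (X Y : {set T}) :
  \sum_(v in X) #|nbh F v :&: Y| = \sum_(v in Y) #|nbh F v :&: X|.
Proof.
have nbE v (Z : {set T}) : #|nbh F v :&: Z| = \sum_(u in Z) link F v u.
  rewrite -sum1_card big_mkcond [RHS]big_mkcond /=; apply: eq_bigr => u _.
  by rewrite !inE andbC; case: (u \in Z) => //=; case: link.
under eq_bigr do rewrite nbE; under [RHS]eq_bigr do rewrite nbE.
by rewrite exchange_big /=; do 2!apply: eq_bigr => ? _; rewrite link_sym.
Qed.

Section Density.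
Variables (T : finType) (E : {set {set T}}) (r : nat).
Implicit Types (F : {set {set T}}) (u v w x y s : T) (A B : {ffun T -> nat}).
Notation state := ({set {set T}} * {ffun T -> nat})%type.
Implicit Types (p q : state).
Notation U := (reached E).

Definition no_walker : {ffun T -> nat} := [ffun _ => 0].

Lemma add_walkers0 A : add_walkers A no_walker = A.
Proof. by apply/ffunP => v; rewrite !ffunE addn0. Qed.

Lemma walkers_add A B : walkers (add_walkers A B) = walkers A + walkers B.
Proof. by rewrite /walkers -big_split; apply: eq_bigr => v _; rewrite ffunE. Qed.

Lemma walkers1 v : walkers (walker v) = 1.
Proof. by rewrite -(sum_eq1 v); apply: eq_bigr => u _; rewrite ffunE. Qed.

Lemma walkers0 : walkers no_walker = 0.
Proof. by apply: big1 => v _; rewrite ffunE. Qed.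

Lemma remove_walkerK A v : 0 < A v -> add_walkers (remove_walker A v) (walker v) = A.
Proof. by move=> Av; apply/ffunP => x; rewrite !ffunE; have [->|] := eqVneq x v; lia. Qed.

Lemma admissible_sub F A B : admissible E (F, add_walkers A B) -> admissible E (F, A).
Proof.
by case=> lfF d m; split=> // v; move: (d v); rewrite /= ffunE; lia.
Qed.

Lemma walkers_reached p : admissible E p -> walkers p.2 <= 2 * #|U p|.
Proof.
move=> [_ d _]; rewrite mulnC -sum_nat_const /walkers (bigID (mem (U p))) /=.
rewrite [X in _ + X]big1 ?addn0; last first.
  by move=> v; apply: contraNeq; rewrite -lt0n => /reached_self->.
by apply: leq_sum => v _; move: (d v); lia.
Qed.

Section Optimal.
Variable p : state.
Notation W := (U p).
Hypothesis okp : admissible E p.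
Hypothesis Wdeg : forall v, v \in W -> r <= deg E v.
Hypothesis opt : forall q, admissible E q -> (forall v, v \in U q -> r <= deg E v) ->
  r * walkers q.2 + 12 * #|W| <= r * walkers p.2 + 12 * #|U q|.

Lemma placed_admissible q B : reach E p (q.1, add_walkers q.2 B) -> admissible E q.
Proof. by case: q => F A /= /reach_admissible/(_ okp)/admissible_sub. Qed.

Lemma placed_sub q B : reach E p (q.1, add_walkers q.2 B) -> U q \subset W.
Proof.
case: q => F A /= pq; apply: subset_trans (reached_add _ _ _ B) _.
exact: reachedS pq.
Qed.

Lemma placed_slack q B : reach E p (q.1, add_walkers q.2 B) ->
  12 * #|W| <= r * walkers B + 12 * #|U q|.
Proof.
move=> pq; have /subsetP S := placed_sub pq.
have := opt (placed_admissible pq) (fun v vU => Wdeg (S v vU)).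
have /= <- := reach_walkers pq; rewrite walkers_add mulnDr; lia.
Qed.

Lemma place q B v : reach E p (q.1, add_walkers q.2 B) -> v \in U q ->
  exists q1, [/\ reach E p (q1.1, add_walkers q1.2 (add_walkers B (walker v))),
    U q1 \subset U q & walkers q1.2 + 1 = walkers q.2].
Proof.
move=> pq /reachedP[q' qq' qv]; exists (q'.1, remove_walker q'.2 v); split=> /=.
- apply: reach_trans pq _; rewrite [add_walkers _ (add_walkers _ _)](_ : _ = add_walkers q'.2 B).
    exact: reach_add.
  apply/ffunP => x; move: qv; rewrite !ffunE.
  by have [->|] := eqVneq x v; lia.
- apply: subset_trans (reachedS qq').
  have := reached_add E q'.1 (remove_walker q'.2 v) (walker v).
  by rewrite (remove_walkerK qv) -surjective_pairing.
- by rewrite -(reach_walkers qq') -[in RHS](remove_walkerK qv) walkers_add walkers1.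
Qed.

(* Otherwise walkers could be placed on [w] and on two of its neighbours, and
   two paths could be merged. *)
Lemma inner_degree w : w \in W -> 12 * #|nbh E w :&: W| <= 2 * r + 12.
Proof.
move=> wW; have p0 : reach E p (p.1, add_walkers p.2 no_walker).
  by rewrite add_walkers0 -surjective_pairing; apply: reach0.
have [q1 [pq1 _ _]] := place p0 wW.
have := placed_slack pq1; rewrite !walkers_add walkers0 !walkers1 => s1.
(* A neighbour in [W] lies in [X] or in [W :\: X], which [placed_slack] makes small. *)
have bound (X : {set T}) k : #|nbh E w :&: X| <= k -> X \subset W ->
    #|nbh E w :&: W| <= #|W| - #|X| + k.
  move=> hk XW; rewrite -(cardsID X (_ :&: W)) addnC leq_add //.
    rewrite -cardsDS //; apply/subset_leq_card.
    by apply: setSD; apply: subsetIr.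
  apply: leq_trans hk; apply/subset_leq_card.
  by rewrite -setIA; apply/setIS/subsetIr.
have [e1|[v]] := set_0Vmem (nbh E w :&: U q1).
  have := bound (U q1) 0; rewrite e1 cards0 => /(_ isT (placed_sub pq1)).
  by lia.
case/setIP; rewrite inE => wv vq1.
have [q2 [pq2 _ _]] := place pq1 vq1.
have := placed_slack pq2; rewrite !walkers_add walkers0 !walkers1 => s2.
(* A third walker at another neighbour [v'] would give [w] degree two in the forest, although [w]
   carries a walker. *)
suff /bound : #|nbh E w :&: U q2| <= 1 by move=> /(_ (placed_sub pq2)); lia.
rewrite -(cards1 v); apply/subset_leq_card/subsetP => v' /setIP[].
rewrite !inE => wv' v'q2; apply/negPn/negP => v'v.
have [q3 r3 h3] := asboolP _ v'q2.
have pq3 := reach_trans pq2 (reach_add (add_walkers (add_walkers no_walker (walker w)) (walker v)) r3).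
have ok3 := reach_admissible pq3 okp.
rewrite link_sym in wv; rewrite link_sym in wv'.
have [||dw _] := seen_twice ok3 v'v wv' wv.
- by rewrite /= !ffunE; lia.
- by rewrite /= !ffunE eqxx; lia.
have := @admissible_deg _ _ _ w ok3; rewrite dw /= !ffunE eqxx; lia.
Qed.

(** By [reach_nbh], every state reached from [p] gives the same set. *)
Definition half := [set y in ~: W | #|nbh p.1 y :&: W| == 1].
Definition seenby B v := [exists u, link E u v && (0 < B u)].
(** The increase of [covered] when one more walker is frozen at [v]; see [covered_add]. *)
Definition gain B v :=
  #|nbh E v :&: [set w in W | ~~ seenby B w]| + #|nbh E v :&: half|.
Definition covered B :=
  #|[set w in W | seenby B w]| + \sum_v B v * #|nbh E v :&: half|.

Lemma seenby_add B v w : seenby (add_walkers B (walker v)) w = seenby B w || link E v w.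
Proof.
apply/existsP/idP => [[u]|/orP[/existsP[u /andP[uw uB]]|vw]].
- rewrite !ffunE => /andP[uw]; have [<-|_] := eqVneq u v; first by rewrite uw orbT.
  by rewrite addn0 => uB; apply/orP; left; apply/existsP; exists u; rewrite uw.
- by exists u; rewrite uw !ffunE ltn_addr.
- by exists v; rewrite vw !ffunE eqxx addn1.
Qed.

(** Diminishing returns: fewer vertices remain unseen, and the half vertices do not depend on
    [B]. *)
Lemma gain_add B v x : gain (add_walkers B (walker v)) x <= gain B x.
Proof.
rewrite leq_add2r; apply/subset_leq_card/subsetP => w; rewrite !inE seenby_add negb_or.
by case/and4P=> -> -> ->.
Qed.

Lemma covered_add B v : covered (add_walkers B (walker v)) = covered B + gain B v.
Proof.
rewrite /covered /gain addnACA; congr (_ + _).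
  rewrite -(cardsID [set w | seenby B w] [set w in W | seenby (add_walkers B (walker v)) w]).
  congr (_ + _); apply: eq_card => w; rewrite !inE seenby_add.
    by case: (seenby B w); rewrite ?andbT ?andbF.
  by case: (seenby B w); rewrite ?andbT ?andbF //= andbC.
rewrite -(mul1n #|nbh E v :&: half|) (_ : 1 * _ = \sum_x (x == v) * #|nbh E x :&: half|).
  by rewrite -big_split; apply: eq_bigr => x _; rewrite !ffunE mulnDl.
by rewrite (bigD1 v) //= eqxx big1 ?addn0 // => x /negPf->.
Qed.

(* Walkers are placed one after the other, always at a reachable vertex of
   maximal gain; by [placed_slack] at most [r / 12] vertices per placed walker
   have become unreachable. *)
Lemma greedy n q B th : walkers q.2 = n -> reach E p (q.1, add_walkers q.2 B) ->
    (forall v, v \in U q -> gain B v <= th) ->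
  exists F' B', [/\ reach E p (F', B'), forall v, gain B' v <= gain B v &
    12 * (\sum_(v in U q) gain B' v) + r * covered B + 12 * #|W| * th <=
    r * covered B' + (r * walkers B + 12 * #|U q|) * th].
Proof.
elim: n q B th => [|n IH] q B th qn pq gth; have sl := placed_slack pq.
  (* Without free walkers nothing is reachable, and the claim is [placed_slack] times [th]. *)
  have q0 v : q.2 v = 0.
    by apply/eqP; rewrite -leqn0 -qn /walkers (bigD1 v) //= leq_addr.
  have Uq : U q = set0.
    apply/setP => v; rewrite [RHS]inE; apply/negP => /reachedP[q' /reach_walkers e].
    by move: qn; rewrite -e /walkers (bigD1 v) //=; lia.
  exists q.1, B; split=> //.
    by move: pq; rewrite (_ : add_walkers _ _ = B) //; apply/ffunP => v; rewrite !ffunE q0.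
  by move: sl; rewrite Uq big_set0 cards0; nia.
have [v0 v0U] : exists v, v \in U q.
  have /existsP[v hv] : [exists v, 0 < q.2 v].
    apply: contraT => /existsPn h; move: qn.
    by rewrite /walkers big1 // => v _; move: (h v); rewrite lt0n negbK => /eqP.
  by exists v; apply: reached_self.
pose v := [arg max_(v > v0 in U q) gain B v].
have [vU vmax] : v \in U q /\ forall x, x \in U q -> gain B x <= gain B v.
  by rewrite /v; case: arg_maxnP.
have [q1 [pq1 sub1 size1]] := place pq vU.
have g1 x : x \in U q1 -> gain (add_walkers B (walker v)) x <= gain B v.
  by move=> /(subsetP sub1)/vmax; apply/leq_trans/gain_add.
have n1 : walkers q1.2 = n by lia.
have [F' [B' [pF' mono]]] := IH q1 _ _ n1 pq1 g1.
rewrite covered_add walkers_add walkers1 => le1.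
exists F', B'; split=> // [x|]; first exact: leq_trans (mono x) (gain_add _ _ _).
(* Each vertex that became unreachable is charged the maximal gain. *)
have sumU : \sum_(x in U q) gain B' x <=
    \sum_(x in U q1) gain B' x + (#|U q| - #|U q1|) * gain B v.
  rewrite (big_setID (U q1)) /= (setIidPr sub1) leq_add2l -cardsDS // -sum_nat_const.
  apply: leq_sum => x /setDP[xU _]; apply: leq_trans (mono x) _.
  exact: leq_trans (gain_add _ _ _) (vmax x xU).
have := gth v vU; have := subset_leq_card sub1.
move: (gain B v) sumU le1 sl => g.
move: (\sum_(x in U q) _) (\sum_(x in U q1) _) #|U q| #|U q1| #|W| (walkers B) (covered B) (covered B').
move=> S S1 u u1 w b vB vB' sumU le1 sl u1u gth'.
(* The [r * g] gained in [covered] cancels the [r * g] due to the additional frozen walker. *)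
have h1 : 12 * S + r * vB + 12 * w * g <= r * vB' + (r * b + 12 * u) * g.
  have : (u - u1) * g + u1 * g = u * g by rewrite -mulnDl subnK.
  by nia.
(* By [placed_slack] the threshold has the larger coefficient on the right, so it may be raised from
   [g] to [th]. *)
have : 12 * w * (th - g) <= (r * b + 12 * u) * (th - g) by rewrite leq_mul2r sl orbT.
have e c : c * th = c * g + c * (th - g) by rewrite -mulnDr subnKC.
by rewrite !e; lia.
Qed.

Lemma optimal_size : 6 < r -> r * walkers p.2 <= 2 * \sum_v (deg E v - r).
Proof.
move=> r6; have p0 : reach E p (p.1, add_walkers p.2 no_walker).
  by rewrite add_walkers0 -surjective_pairing; apply: reach0.
have [|F' [B' [pF' _ le]]] := @greedy _ p no_walker (\max_v gain no_walker v) erefl p0.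
  by move=> v _; apply: leq_bigmax.
have val0 : covered no_walker = 0.
  rewrite /covered big1 ?addn0 => [|v _]; last by rewrite ffunE.
  apply/eqP; rewrite cards_eq0; apply/eqP/setP => w; rewrite !inE.
  by apply/negP => /andP[_ /existsP[u]]; rewrite ffunE andbF.
(* Initially nothing is frozen and all of [W] is reachable, so the threshold terms cancel. *)
move: le; rewrite val0 walkers0 muln0 addn0 add0n leq_add2r => le.
have okF := reach_admissible pF' okp; have [lfF dF _] := okF.
have UW := reachedS pF'.
have Bsize := reach_walkers pF'.
pose f v := #|nbh F' v :&: W|; pose d v := #|nbh E v :&: W|.
have fnb v : v \notin W -> f v = #|nbh p.1 v :&: W|.
  by move=> vW; rewrite /f (reach_nbh pF').
have c1 : \sum_v f v + walkers p.2 <= 2 * #|W|.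
  have -> : \sum_v f v = \sum_(v in W) deg F' v.
    have := exchange_nbh F' setT W; rewrite (eq_bigl _ _ (fun v => in_setT v)) /f => ->.
    by apply: eq_bigr => v _; rewrite setIT.
  rewrite -Bsize /walkers /= (bigID (mem W) predT) /= [X in _ + (_ + X)]big1 ?addn0.
    rewrite -big_split mulnC -sum_nat_const; apply: leq_sum => v _.
    by move: (dF v); rewrite /= addnC.
  by move=> v; apply: contraNeq; rewrite -lt0n => /(@reached_self _ E (F', B'))/(subsetP UW).
have c2 : r * #|W| <= \sum_v d v.
  have -> : \sum_v d v = \sum_(v in W) deg E v.
    have := exchange_nbh E setT W; rewrite (eq_bigl _ _ (fun v => in_setT v)) /d => ->.
    by apply: eq_bigr => v _; rewrite setIT.
  by rewrite mulnC -sum_nat_const; apply: leq_sum.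
pose unseen := [set w in W | ~~ seenby B' w].
have c3 : \sum_(v in W) gain B' v = \sum_(w in unseen) d w + \sum_(y in half) d y.
  by rewrite /gain big_split; congr (_ + _); apply: exchange_nbh.
have f1 y : y \in half -> f y = 1.
  by rewrite inE in_setC => /andP[yW /eqP]; rewrite fnb.
(* A half vertex is seen from at most one vertex, which carries at most two walkers. *)
have c4 : covered B' <= #|[set w in W | seenby B' w]| + 2 * #|half|.
  rewrite leq_add2l mulnC -sum_nat_const.
  have -> : \sum_v B' v * #|nbh E v :&: half| = \sum_(y in half) \sum_v B' v * link E v y.
    rewrite exchange_big /=; apply: eq_bigr => v _; rewrite -big_distrr /=.
    congr (_ * _); rewrite -sum1_card big_mkcond [RHS]big_mkcond /=.
    by apply: eq_bigr => y _; rewrite in_setI [y \in nbh E v]inE andbC; case: (y \in half) => //=; case: link.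
  apply: leq_sum => y yh.
  have [/existsP[u /andP[uy uB]]|/existsPn ns] := boolP (seenby B' y); last first.
    rewrite big1 // => v _; move: (ns v); rewrite negb_and.
    by case: link => /=; rewrite ?muln0 // -leqNgt leqn0 muln1 => /eqP.
  rewrite (bigD1 u) //= big1 ?addn0.
    by move: (dF u) (leq_b1 (link E u y)); rewrite /=; nia.
  move=> v vu; apply/eqP; rewrite muln_eq0; apply: contraT; rewrite negb_or -lt0n.
  case/andP=> vB; rewrite eqb0 negbK => vy.
  have [d2 nbU] := seen_twice okF vu vy uy vB uB.
  have := f1 y yh; rewrite /f (setIidPl (subset_trans nbU UW)) => d1.
  by move: d2; rewrite /deg d1.
have seen_f v : seenby B' v -> 0 < f v.
  move=> /(seen_free okF)[s vs sU]; apply/card_gt0P; exists s.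
  by rewrite in_setI [s \in nbh _ _]inE vs; apply: (subsetP UW).
(* Seen vertices of [W] have [12 * d v <= 2 * r + 12] and [f v >= 1]; unseen and half vertices keep
   [12 * d v] on the right; all others with [d v > 0] have [f v >= 2]. *)
have c5 v : 12 * d v + ((v \in W) && seenby B' v) * (4 * r - 12) + (v \in half) * (6 * r)
    <= 6 * r * f v + 12 * (deg E v - r) + (v \in unseen) * (12 * d v) + (v \in half) * (12 * d v).
  have dE : d v <= deg E v by apply/subset_leq_card/subsetIl.
  have [vW|vW] := boolP (v \in W).
    have -> : v \in half = false by rewrite inE in_setC vW.
    have -> : v \in unseen = ~~ seenby B' v by rewrite inE vW.
    have [sv|nsv] /= := boolP (seenby B' v); last by lia.
    by have := inner_degree vW; have := seen_f v sv; rewrite -/(d v); nia.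
  have -> : v \in unseen = false by rewrite inE (negPf vW).
  have [vh|vh] := boolP (v \in half); first by rewrite f1 //=; lia.
  have [->|dv] := posnP (d v); first by lia.
  (* Some walker gets next to [v], which then has a forest neighbour in [W]. The number of these
     never changes, and it is not one as [v] is not half. *)
  suff : 1 < f v by rewrite /=; nia.
  case/card_gt0P: (dv) => u; case/setIP; rewrite inE => vu /reachedP[q pq qu].
  have : seen E q v by apply/existsP; exists u; rewrite link_sym vu.
  case/(seen_free (reach_admissible pq okp)) => s vs sU.
  have : 0 < #|nbh p.1 v :&: W|.
    rewrite -(reach_nbh pq (subxx _) vW); apply/card_gt0P; exists s.
    by rewrite in_setI [s \in nbh _ _]inE vs; apply: (subsetP (reachedS pq)).
  rewrite fnb //; move: vh; rewrite inE in_setC vW /=.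
  by case: #|_| => [|[]].
have := leq_sum (index_enum T) (P := predT) (fun v _ => c5 v).
rewrite !big_split /= -!big_distrr /= -!big_distrl /=.
have cnt (X : {set T}) : \sum_v (v \in X : nat) = #|X|.
  by rewrite -sum1_card [RHS]big_mkcond; apply: eq_bigr => v _; case: (v \in X).
have cntd (X : {set T}) : \sum_v (v \in X) * (12 * d v) = 12 * \sum_(v in X) d v.
  by rewrite big_distrr [RHS]big_mkcond; apply: eq_bigr => v _; case: (v \in X); rewrite ?mul1n.
rewrite !cnt !cntd.
have -> : \sum_v ((v \in W) && seenby B' v : nat) = #|[set w in W | seenby B' w]|.
  by rewrite -cnt; apply: eq_bigr => v _; rewrite inE.
move: c1 c2 le c4; rewrite c3.
move: (\sum_v f v) (\sum_v d v) (\sum_v (deg E v - r)) (\sum_(v in unseen) d v) (\sum_(v in half) d v).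
move: #|[set w in W | seenby B' w]| #|W| #|half| (covered B') (walkers p.2).
move=> cov w h vB a f' d' X S1 S2 c1 c2 le c4 main.
(* Adding [c5] to 6 times [h1], 12 times [c2], [le] and [h2] leaves [6 * r * a + (3 * r - 12) * cov
   + 4 * r * h <= 12 * d']. *)
have h1 : r * (f' + a) <= r * (2 * w) by rewrite leq_mul2l c1 orbT.
have h2 : r * vB <= r * (cov + 2 * h) by rewrite leq_mul2l c4 orbT.
have h3 : cov * (4 * r - 12) = 4 * (r * cov) - 12 * cov by rewrite mulnBr; lia.
have h4 : 6 * cov <= r * cov by rewrite leq_mul2r (ltnW r6) orbT.
by rewrite h3 in main; lia.
Qed.

End Optimal.

(** Compare [p] with a state maximizing [r * walkers - 12 * #|U|]. For [r <= 6] two walkers per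
    vertex are within the bound anyway. *)
Lemma density p : admissible E p -> (forall v, v \in U p -> r <= deg E v) ->
  r * walkers p.2 <= 12 * #|U p| + 2 * \sum_v (deg E v - r).
Proof.
move=> okp Wp; have [r6|r6] := leqP r 6.
  by have := walkers_reached okp; nia.
(* The summand [12 * #|T|] keeps the maximized quantity a natural number. *)
pose P n := `[< exists q, [/\ admissible E q, forall v, v \in U q -> r <= deg E v &
  n + 12 * #|U q| = r * walkers q.2 + 12 * #|T|] >].
have exP : exists n, P n.
  exists (r * walkers p.2 + 12 * #|T| - 12 * #|U p|); apply/asboolP; exists p; split=> //.
  by have : #|U p| <= #|T| := max_card _; lia.
have bP n : P n -> n <= r * (2 * #|T|) + 12 * #|T|.
  case/asboolP=> q [okq _ e]; have := walkers_reached okq; have : #|U q| <= #|T| := max_card _.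
  nia.
have [m /asboolP[q [okq Wq e]] mmax] := ex_maxnP exP bP.
have optq q' : admissible E q' -> (forall v, v \in U q' -> r <= deg E v) ->
    r * walkers q'.2 + 12 * #|U q| <= r * walkers q.2 + 12 * #|U q'|.
  move=> okq' Wq'; have U'T : #|U q'| <= #|T| := max_card _.
  have /mmax : P (r * walkers q'.2 + 12 * #|T| - 12 * #|U q'|).
    by apply/asboolP; exists q'; split=> //; lia.
  lia.
have := optimal_size okq Wq optq r6; have := optq p okp Wp.
have : #|U q| <= #|T| := max_card _; lia.
Qed.

End Density.

(** * A linear forest with few ends *)

Section FewEnds.
Variables (T : finType) (E : {set {set T}}).
Implicit Types (F : {set {set T}}) (v x : T).

(** For a linear forest, the number of path ends on these vertices, isolated vertices of [F]
    counting twice. *)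
Definition deficit i F := \sum_(v | i <= deg E v) (2 - deg F v).

(** Level by level: the next forest minimizes [deficit k] among those not worse than the previous
    one below [k]. *)
Lemma lex_min k : exists2 F, lforest E F & forall F' r, lforest E F' -> r < k ->
  (forall j, j < r -> deficit j F' <= deficit j F) ->
  deficit r F <= deficit r F'.
Proof.
elim: k => [|k [F lfF IH]]; first by exists set0; [exact: lforest0|].
pose P n := `[< exists F', [/\ lforest E F', forall j, j < k -> deficit j F' <= deficit j F &
  deficit k F' = n] >].
have exP : exists n, P n by exists (deficit k F); apply/asboolP; exists F.
have [m /asboolP[F1 [lf1 le1 <-]] min1] := ex_minnP exP.
exists F1 => // F' r lf' rk le'.
have [{}rk|kr] := ltnP r k.
  apply: leq_trans (le1 r rk) _; apply: IH => // j jr.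
  by apply: leq_trans (le' j jr) (le1 j _); apply: ltn_trans rk.
have {}kr : r = k by apply/eqP; rewrite eqn_leq kr andbT.
subst r; apply: min1; apply/asboolP; exists F'; split=> // j jk.
exact: leq_trans (le' j jk) (le1 j jk).
Qed.

Lemma deg_le v : deg E v <= #|T|.
Proof. exact: max_card. Qed.

Lemma lforest_few_ends : exists2 F, lforest E F &
  forall r, r * #|[set v | (r <= deg E v) && (deg F v <= 1)]| <=
    12 * \sum_v ((deg E v).+1 - r).
Proof.
have [F lfF lexF] := lex_min #|T|.+1; exists F => // r.
have [rT|rT] := leqP r #|T|; last first.
  rewrite (_ : [set v | _] = set0) ?cards0 ?muln0 //.
  apply/setP => v; rewrite !inE leqNgt (leq_ltn_trans (deg_le v) rT).
  by [].
pose A : {ffun T -> nat} := [ffun v => (r <= deg E v) && (deg F v <= 1) : nat].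
have [_ d2 _] := lfF.
(* Minimal [deficit 0] thus means maximal volume. *)
have volE F' : lforest E F' -> deficit 0 F' + volume F' = 2 * #|T|.
  move=> [_ d2' _]; rewrite /deficit /volume -big_split /= mulnC -sum_nat_const.
  by apply: eq_bigr => v _; rewrite subnK.
have okp : admissible E (F, A).
  split=> // [v|F' lf'] /=; first by rewrite ffunE; move: (d2 v); lia.
  by have := lexF F' 0 lf' isT (fun j => ltac:(by [])); have := volE _ lfF; have := volE _ lf'; lia.
have sizeA j : j <= r -> \sum_(v | j <= deg E v) A v = walkers A.
  move=> jr; rewrite big_mkcond; apply: eq_bigr => v _; rewrite ffunE.
  by case: leqP => //= dj; rewrite leqNgt (leq_trans dj jr).
(* All walkers start at degree at least [r]; if one came to a lower degree, [deficit r] would drop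
   and no earlier deficit would grow. *)
have Udeg v : v \in reached E (F, A) -> r <= deg E v.
  case/reachedP => q pq qv; rewrite leqNgt; apply/negP => dv.
  have [lfq dq _] := reach_admissible pq okp.
  have sizeq : walkers q.2 = walkers A := reach_walkers pq.
  have qA j : j <= r -> deficit j q.1 + walkers A = deficit j F + \sum_(x | j <= deg E x) q.2 x.
    move=> jr; rewrite -(sizeA j jr) -!big_split; apply: eq_bigr => x _.
    move: (reach_deg x pq) (dq x) => /=.
    have [_ Ad _] := okp; move: (Ad x) => /=; lia.
  have split_q j : \sum_(x | j <= deg E x) q.2 x + \sum_(x | ~~ (j <= deg E x)) q.2 x = walkers q.2.
    by rewrite /walkers [RHS](bigID (fun x => j <= deg E x)).
  have := lexF q.1 r lfq; rewrite ltnS rT => /(_ isT).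
  have le j : j < r -> deficit j q.1 <= deficit j F.
    by move=> /ltnW/qA; move: (split_q j); lia.
  move=> /(_ le); move: (qA r (leqnn r)) (split_q r).
  by rewrite [in X in _ -> X -> _](bigD1 v (P := fun x => ~~ _)) -?ltnNge //=; lia.
have := density okp Udeg.
have -> : walkers (F, A).2 = #|[set v | (r <= deg E v) && (deg F v <= 1)]|.
  rewrite /walkers -sum1_card [RHS]big_mkcond; apply: eq_bigr => v _.
  by rewrite inE /= ffunE; case: (_ && _).
(* A reached vertex has degree [d >= r], where [12 + 2 * (d - r) <= 12 * (d.+1 - r)]. *)
move/leq_trans; apply; rewrite -sum1_card [\sum_(_ in _) 1]big_mkcond /= !big_distrr -big_split /=.
apply: leq_sum => v _; case: ifP => [/Udeg|_]; lia.
Qed.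

End FewEnds.

(** * Estimates for powers of two and Bernoulli's inequality *)

Section Numeric.

Lemma expn2_sum R d M : d <= M -> 2 ^ d <= 2 ^ R + \sum_(i < M | R <= i < d) 2 ^ i.
Proof.
elim: d => [|d IH] dM; first by rewrite (leq_trans _ (leq_addr _ _)) // expn_gt0.
have [dR|Rd] := ltnP d R; first by rewrite (leq_trans _ (leq_addr _ _)) // leq_exp2l.
rewrite (bigD1 (Ordinal dM)) /= ?Rd ?ltnSn //.
rewrite expnS mul2n -addnn addnCA leq_add2l.
apply: leq_trans (IH (ltnW dM)) _; rewrite leq_add2l.
rewrite [leqLHS](eq_bigl (fun i : 'I_M => (R <= i < d.+1) && (i != Ordinal dM))) //.
by move=> i; rewrite -val_eqE /= ltnS; case: ltngtP; rewrite ?andbT ?andbF.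
Qed.

(** Passing from [d] to [d.+1] adds at most the geometric sum of [2 ^ i] over [i <= d]. *)
Lemma expn2_weighted M d : \sum_(i < M) 2 ^ i * (d - i) <= 2 ^ d.+1.
Proof.
elim: d => [|d IH].
  by rewrite big1 // => i _; rewrite sub0n muln0.
have lt2 : \sum_(i < M) 2 ^ i * (i <= d) <= 2 ^ d.+1.
  elim: M {IH} => [|M IH]; first by rewrite big_ord0.
  rewrite big_ord_recr /=; have [Md|dM] := leqP M d; last by rewrite muln0 addn0.
  rewrite muln1 (eq_bigr (fun i : 'I_M => 2 ^ i)) => [|i _]; last first.
    by rewrite (leq_trans (ltnW (ltn_ord i)) Md) muln1.
  apply: leq_trans (_ : 2 ^ M.+1 <= _); last by rewrite leq_exp2l.
  rewrite [leqRHS]expnS mul2n -addnn leq_add2r.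
  elim: M {IH Md} => [|M IH]; first by rewrite big_ord0.
  by rewrite big_ord_recr /= expnS mul2n -addnn leq_add2r.
rewrite expnS mul2n -addnn; apply: leq_trans (leq_add IH lt2).
rewrite -big_split /=; apply: leq_sum => i _; rewrite -mulnDr leq_mul2l.
by apply/orP; right; lia.
Qed.

Lemma leq_expn2_half D : D <= 2 * 2 ^ (D - D./2).
Proof.
have : D - D./2 < 2 ^ (D - D./2) by apply: ltn_expl.
by have := odd_double_half D; lia.
Qed.

(** This is [1 + 2m/D <= (1 + 2/D)^m], cleared of denominators. *)
Lemma bernoulli D m : (D + 2 * m) * D ^ m <= D * (D + 2) ^ m.
Proof.
elim: m => [|m IH]; first by rewrite muln0 addn0.
rewrite !expnS.
apply: leq_trans (_ : (D + 2) * ((D + 2 * m) * D ^ m) <= _).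
  by move: (D ^ m) => x; nia.
by rewrite [leqRHS]mulnCA leq_mul2l IH orbT.
Qed.

End Numeric.

(** * Removing linear forests repeatedly *)

Section Peeling.
Variable T : finType.
Implicit Types (E F : {set {set T}}) (u v x : T).

Lemma link_setD E F u v : link (E :\: F) u v = link E u v && ~~ link F u v.
Proof. by rewrite /link !inE; case: (u == v) => //=; rewrite andbC. Qed.

Lemma deg_setD E F v : F \subset E -> deg (E :\: F) v + deg F v = deg E v.
Proof.
move=> FE; rewrite /deg -(cardsID (nbh F v) (nbh E v)) addnC; congr (_ + _).
  apply: eq_card => u; rewrite !inE.
  by case: (boolP (link F v u)) => [/(linkS FE)->|]; rewrite ?andbF ?andbT.
by apply: eq_card => u; rewrite !inE link_setD andbC.
Qed.

Definition weight E := \sum_v 2 ^ deg E v.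

Lemma weight_step E D : exists2 F, lforest E F &
  4 * D * weight (E :\: F) <= (D + 144) * weight E + 6 * (#|T| * 2 ^ D).
Proof.
have [F lfF exF] := lforest_few_ends E; exists F => //.
have [FE d2 _] := lfF.
pose ends := [set v | deg F v <= 1].
(* Degree two in [F] divides [2 ^ deg] by four; the other vertices are charged in full. *)
have w1 : 4 * weight (E :\: F) <= weight E + 3 * \sum_(v in ends) 2 ^ deg E v.
  rewrite /weight !big_distrr /= [X in _ + X]big_mkcond -big_split /=.
  apply: leq_sum => v _; rewrite -(deg_setD v FE) inE.
  move: (d2 v); case: (deg F v) => [|[|[|//]]] _ /=.
  - by rewrite addn0; lia.
  - by rewrite addn1 expnS; lia.
  - by rewrite addn2 !expnS; lia.
pose a i := #|[set v | (i < deg E v) && (deg F v <= 1)]|.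
have w2 : \sum_(v in ends) 2 ^ deg E v <=
    #|T| * 2 ^ D./2 + \sum_(i < #|T| | D./2 <= i) 2 ^ i * a i.
  have -> : \sum_(i < #|T| | D./2 <= i) 2 ^ i * a i =
      \sum_(v in ends) \sum_(i < #|T| | D./2 <= i < deg E v) 2 ^ i.
    under eq_bigr => v _ do rewrite big_mkcondr.
    rewrite exchange_big /=; apply: eq_bigr => i _.
    rewrite -big_mkcondr /a -[#|[set _ | _]|]sum1_card big_distrr /=.
    by apply: eq_big => [v|v _]; rewrite ?inE ?muln1 // andbC.
  rewrite -sum_nat_const [X in X + _](bigID (mem ends)) /=.
  apply: leq_trans (leq_add (leq_addr _ _) (leqnn _)).
  rewrite -big_split; apply: leq_sum => v _; apply: expn2_sum.
  exact: deg_le.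
have w3 : D * \sum_(i < #|T| | D./2 <= i) 2 ^ i * a i <= 48 * weight E.
  rewrite big_distrr /=.
  apply: leq_trans (_ : \sum_(i < #|T|) 24 * (2 ^ i * \sum_v (deg E v - i)) <= _).
    rewrite big_mkcond; apply: leq_sum => i _; case: ifP => // Di.
    (* Since [D <= 2 * i.+1], the bound for [r = i.+1] costs [24 = 2 * 12]. *)
    have := exF i.+1; rewrite -/(a i) => ai.
    rewrite mulnCA [leqRHS]mulnCA leq_mul2l; apply/orP; right.
    apply: leq_trans (_ : 2 * (i.+1 * a i) <= _).
      by rewrite mulnA leq_mul2r; apply/orP; right; have := odd_double_half D; lia.
    by rewrite -[24]/(2 * 12) -mulnA leq_mul2l.
  rewrite -big_distrr /= -[48]/(24 * 2) -mulnA leq_mul2l /= /weight big_distrr /=.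
  under eq_bigr => i _ do rewrite big_distrr.
  rewrite exchange_big /=; apply: leq_sum => v _.
  by rewrite -expnS; apply: expn2_weighted.
have w4 : D * 2 ^ D./2 <= 2 * 2 ^ D.
  have hD : D./2 <= D by have := odd_double_half D; lia.
  have -> : 2 ^ D = 2 ^ (D - D./2) * 2 ^ D./2 by rewrite -expnD subnK.
  by rewrite mulnA leq_mul2r leq_expn2_half orbT.
move: w1 w2 w3; set S := \sum_(v in ends) _; set S' := \sum_(i < _ | _) _.
move=> w1 w2 w3.
have h1 : D * S <= #|T| * (D * 2 ^ D./2) + D * S'.
  by rewrite mulnCA -mulnDr leq_mul2l w2 orbT.
have h2 : #|T| * (D * 2 ^ D./2) <= #|T| * (2 * 2 ^ D) by rewrite leq_mul2l w4 orbT.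
have h3 : D * (4 * weight (E :\: F)) <= D * (weight E + 3 * S) by rewrite leq_mul2l w1 orbT.
lia.
Qed.

Inductive peel E : nat -> {set {set T}} -> Prop :=
| peel0 : peel E 0 E
| peelS k F E' : peel E k E' -> lforest E' F -> peel E k.+1 (E' :\: F).

(** The left-hand side does not increase with [k]; [D - 2 * k] is the maximum degree if every round
    lowered it by two. *)
Lemma peel_weight m E D k : 72 <= m -> 2 * k <= D -> exists2 E', peel E k E' &
  4 ^ k * (weight E' + #|T| * 2 ^ (D - 2 * k)) * (D - 2 * k + 2) ^ m <=
  (weight E + #|T| * 2 ^ D) * (D + 2) ^ m.
Proof.
move=> m72; elim: k => [_|k IH kD].
  by exists E; [exact: peel0|rewrite mul1n subn0].
have [|E' pE' le'] := IH; first by lia.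
have [F lfF b] := weight_step E' (D - 2 * k).
exists (E' :\: F); first exact: peelS pE' lfF.
apply: leq_trans le'; rewrite expnSr -!mulnA leq_mul2l; apply/orP; right.
have [D' e] : exists D', D - 2 * k = D'.+2 by exists (D - 2 * k - 2); lia.
have -> : D - 2 * k.+1 = D' by lia.
rewrite e in b *; rewrite !addn2.
rewrite -(@leq_pmul2l D'.+2) //.
(* The loss [1 + 144 / D] of [weight_step] is paid by [(1 + 2 / D)^m], as [2 * m >= 144]. *)
have bern := bernoulli D'.+2 m; rewrite addn2 in bern.
have eN : #|T| * 2 ^ D'.+2 = 4 * (#|T| * 2 ^ D') by rewrite !expnS mulnCA; lia.
rewrite eN in b *; move: (#|T| * 2 ^ D') (weight E') (weight _) b => x w w' b.
apply: leq_trans (_ : (D'.+2 + 144) * (w + 4 * x) * D'.+2 ^ m <= _).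
  rewrite !mulnA leq_mul2r; apply/orP; right; lia.
rewrite mulnAC [leqRHS]mulnCA [leqRHS]mulnC leq_mul2r; apply/orP; right.
apply: leq_trans bern; rewrite leq_mul2r; apply/orP; right; lia.
Qed.

(** In a linear forest with as many edges as possible, an edge between two isolated vertices could
    be added. *)
Lemma lforest_covers_edges E : exists2 F, lforest E F &
  forall u v, link E u v -> 0 < deg F u + deg F v.
Proof.
pose P n := `[< exists2 F, lforest E F & #|F| = n >].
have exP : exists n, P n by exists #|@set0 {set T}|; apply/asboolP; exists set0 => //; apply: lforest0.
have bP n : P n -> n <= #|{set T}| by case/asboolP=> F _ <-; apply: max_card.
have [n /asboolP[F lfF <-] max] := ex_maxnP exP bP.
exists F => // u v uv; rewrite lt0n; apply/negP; rewrite addn_eq0 => /andP[/eqP du /eqP dv].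
have unv : u != v by case/andP: uv.
have nc : ~~ connect (link F) u v.
  apply/negP => /(connect_last unv)[s sv _]; move/eqP: dv.
  by rewrite cards_eq0 => /eqP/setP/(_ s); rewrite !inE link_sym sv.
have lf' : lforest E ([set u; v] |: F) by apply: lforestU1 => //; rewrite ?du ?dv.
have /max : P #|[set u; v] |: F| by apply/asboolP; exists ([set u; v] |: F).
rewrite cardsU1; suff -> : [set u; v] \notin F by rewrite ltnn.
by apply: contra nc => uvF; apply: connect1; rewrite /link unv.
Qed.

(** Each round lowers the degree sum of every surviving edge; such a sum is at least two, hence
    [s.+1]. *)
Lemma peel_rest E0 k s E : peel E0 k E ->
  (forall u v, link E u v -> deg E u + deg E v <= s.+1) ->
  exists2 E', peel E0 (k + s) E' & forall u v, ~~ link E' u v.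
Proof.
elim: s k E => [|s IH] k E pE dE.
  exists E => [|u v]; first by rewrite addn0.
  apply/negP => uv; have := dE u v uv.
  have pos x y : link E x y -> 0 < deg E x.
    by move=> xy; apply/card_gt0P; exists y; rewrite inE.
  by have := pos _ _ uv; rewrite link_sym in uv; have := pos _ _ uv; lia.
have [F lfF cov] := lforest_covers_edges E; have [FE _ _] := lfF.
rewrite addnS -addSn; apply: (IH _ (E :\: F)); first exact: peelS pE lfF.
move=> u v uv; have := linkS (subsetDl E F) uv => uvE.
by have := dE u v uvE; have := cov u v uvE; rewrite -(deg_setD u FE) -(deg_setD v FE); lia.
Qed.

Lemma peel_partition E k E' : peel E k E' -> E' = set0 ->
  exists P : {set {set {set T}}}, [/\ partition P E, #|P| <= k &
    forall F, F \in P -> exists E1, lforest E1 F].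
Proof.
move=> pE E'0; subst E'.
suff: exists P : {set {set {set T}}}, [/\ partition P (E :\: set0), #|P| <= k &
    forall F, F \in P -> exists E1, lforest E1 F] by rewrite setD0.
move: (@set0 {set T}) pE => E' pE.
have [] : E' \subset E /\ exists P : {set {set {set T}}},
    [/\ partition P (E :\: E'), #|P| <= k &
    forall F, F \in P -> exists E1, lforest E1 F]; last by [].
elim: pE => [|{}k F {}E' _ [E'E [P [partP Pk lfP]]] lfF].
  by split=> //; exists set0; rewrite setDv cards0 partition_set0 eqxx; split=> // F; rewrite inE.
have [FE' _ _] := lfF.
split; first exact: subset_trans (subsetDl _ _) E'E.
have eE : E :\: (E' :\: F) = (E :\: E') :|: F.
  apply/setP => e; rewrite !inE; have := subsetP FE' e; have := subsetP E'E e.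
  by case: (e \in F); case: (e \in E'); case: (e \in E) => //= h1 h2; by [have := h1 isT|have := h2 isT].
(* A partition has no empty class, so an empty forest is skipped. *)
have [F0|Fn0] := eqVneq F set0.
  exists P; rewrite eE F0 setU0; split=> //; exact: leqW.
exists (F |: P); split.
- rewrite eE [_ :\: _ :|: F]setUC; apply: partitionU1 => //.
  rewrite -setI_eq0; apply/eqP/setP => e; rewrite !inE.
  by have := subsetP FE' e; case: (e \in F) => //= ->.
- rewrite cardsU1; case: (F \notin P); rewrite ?add1n ?add0n //; exact: leqW.
- move=> F1; rewrite in_setU1 => /orP[/eqP->|/lfP//].
  by exists E'.
Qed.

End Peeling.

(** * Back to sequences of vertices *)

Section Paths.
Variable T : finType.
Implicit Types (E F : {set {set T}}) (u v x y : T) (p q : seq T).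

Lemma path_edges_cons x y p :
  path_edges (x :: y :: p) = [set x; y] |: path_edges (y :: p).
Proof. by apply/setP => e; rewrite !inE. Qed.

Lemma path_edges1 x : path_edges [:: x] = set0.
Proof. by apply/setP => e; rewrite !inE. Qed.

Lemma path_edges_cat p x y q : path_edges (rcons p x ++ y :: q) =
  path_edges (rcons p x) :|: ([set x; y] |: path_edges (y :: q)).
Proof.
elim: p => [|z [|z' p] IH] /=; first by rewrite path_edges_cons path_edges1 set0U.
  by rewrite 2!path_edges_cons [path_edges [:: z; x]]path_edges_cons path_edges1 setU0 !setUA.
by rewrite path_edges_cons -cat_cons IH path_edges_cons !setUA.
Qed.

Lemma path_edges_rev p : path_edges (rev p) = path_edges p.
Proof.
elim: p => [|x [|y p] IH]; rewrite ?rev_cons //.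
rewrite path_edges_cons -IH !rev_cons -[rcons (rcons _ _) _]cats1 path_edges_cat.
by rewrite path_edges1 setU0 setUC [[set y; x]]setUC.
Qed.

Lemma path_connect F p x y : uniq p -> path_edges p \subset F ->
  x \in p -> y \in p -> connect (link F) x y.
Proof.
case: p => // a p up pF.
have from_a z : z \in a :: p -> connect (link F) a z.
  elim: p a up pF => [|b p IH] a; first by rewrite inE => _ _ /eqP->; rewrite connect0.
  rewrite cons_uniq path_edges_cons subUset sub1set => /andP[anb ubp] /andP[abF bF].
  rewrite inE => /predU1P[->|zp]; first exact: connect0.
  apply: connect_trans (IH b ubp bF zp); apply: connect1.
  by rewrite /link abF andbT; apply: contraNneq anb => ->; rewrite mem_head.
by move=> xp yp; apply: connect_trans (from_a y yp); rewrite link_connect_sym from_a.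
Qed.

(** An inner vertex of the path would have two neighbours; if [u] comes first, the path is
    reversed. *)
Lemma path_end F p u : uniq p -> path_edges p \subset F -> u \in p ->
  deg F u <= 1 -> exists p1, perm_eq (rcons p1 u) p /\
    path_edges (rcons p1 u) = path_edges p.
Proof.
move=> + + up; case/splitPr: up => p1 p2 up pF du.
case: p2 up pF => [|b p2] up pF; first by exists p1; rewrite -cats1.
case/lastP: p1 up pF => [|p1 a] up pF.
  by exists (rev (b :: p2)); rewrite -rev_cons perm_rev path_edges_rev.
move: pF; rewrite path_edges_cat path_edges_cons !subUset !sub1set.
case/and3P=> _ auF /andP[ubF _].
move: up; rewrite cat_uniq cons_uniq => /and3P[_ /hasPn h /andP[unb _]].
have nota x : x \in [:: u, b & p2] -> a != x.
  by move=> /h; apply: contraNneq => ->; rewrite mem_rcons mem_head.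
have /negP[] : a != b by apply: nota; rewrite !inE eqxx orbT.
apply/eqP/(card_le1_eqP du); rewrite inE /link.
  by rewrite ubF andbT; apply: contraNneq unb => ->; rewrite mem_head.
by rewrite setUC auF andbT eq_sym nota ?mem_head.
Qed.

(** After deleting an edge [uv], a bridge, [u] and [v] are ends of different paths, which [uv]
    joins. The first hypothesis excludes sets that [link] ignores. *)
Lemma lforest_linear_forest E F : (forall e, e \in F -> exists x y, x != y /\ e = [set x; y]) ->
  lforest E F -> linear_forest F.
Proof.
(* The paths are made to cover all vertices, so that [u] and [v] lie on paths of the induction
   hypothesis. *)
move=> simpleF lfF; suff [ps [ps0 ups eF _]] : exists ps : seq (seq T),
  [/\ [::] \notin ps, uniq (flatten ps), F = \bigcup_(p <- ps) path_edges p &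
   forall x, x \in flatten ps] by exists ps.
have [n] := ubnP #|F|; elim: n => // n IH in F simpleF lfF *; rewrite ltnS => Fn.
have [->|[e eF]] := set_0Vmem F.
  exists [seq [:: x] | x <- enum T].
  have -> : flatten [seq [:: x] | x <- enum T] = enum T by elim: (enum T) => //= x s ->.
  split; rewrite ?enum_uniq //.
  - by apply/mapP => -[].
  - rewrite big_map big1 // => x _; exact: path_edges1.
  - by move=> x; rewrite mem_enum.
have [u [v [uv ee]]] := simpleF e eF; subst e.
have luv : link F u v by rewrite /link uv.
set F' := F :\ [set u; v]; have lfF' : lforest E F' := lforestD1 [set u; v] lfF.
have [_ d2 br] := lfF.
have [||ps [ps0 ups eF' cov]] := IH F' _ lfF'.
- by move=> e /setD1P[_ /simpleF].
- by move: Fn; rewrite (cardsD1 [set u; v] F) eF.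
have /flattenP[p pps up] := cov u; have /flattenP[q qps vq] := cov v.
have sub_ps p0 : p0 \in ps -> path_edges p0 \subset F'.
  by move=> h; rewrite eF' (big_rem p0) // subsetUl.
have uniq_ps p0 : p0 \in ps -> uniq p0.
  elim: (ps) ups => //= p1 s IHs; rewrite cat_uniq => /and3P[u1 _ us].
  by rewrite inE => /predU1P[->|/(IHs us)].
have nuv := br u v luv.
have qp : q \in rem p ps.
  have : q \in p :: rem p ps by rewrite -(perm_mem (perm_to_rem pps)).
  rewrite inE => /predU1P[qp|//]; subst q; case/negP: nuv.
  exact: path_connect (uniq_ps _ pps) (sub_ps _ pps) up vq.
have du : deg F' u <= 1.
  by have := d2 u; rewrite -(degD1 u luv) eqxx addn1 addSn ltnS; apply/leq_trans/leq_addr.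
have dv : deg F' v <= 1.
  by have := d2 v; rewrite -(degD1 v luv) eqxx addn1 ltnS; apply/leq_trans/leq_addr.
have [p1 [perm_p ep]] := path_end (uniq_ps _ pps) (sub_ps _ pps) up du.
have [q1 [perm_q eq]] := path_end (uniq_ps _ qps) (sub_ps _ qps) vq dv.
set ps' := rem q (rem p ps).
have perm_ps : perm_eq ps [:: p, q & ps'].
  by apply: perm_trans (perm_to_rem pps) _; rewrite perm_cons perm_to_rem.
have perm_fl : perm_eq (flatten ps) (flatten ((rcons p1 u ++ v :: rev q1) :: ps')).
  apply: perm_trans (perm_flatten perm_ps) _; rewrite /= catA -rev_rcons.
  rewrite perm_cat2r perm_sym; apply: perm_cat => //.
  by apply: perm_trans perm_q; rewrite perm_rev.
exists ((rcons p1 u ++ v :: rev q1) :: ps'); split.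
- rewrite inE negb_or; apply/andP; split; first by case: (p1).
  by apply: contra ps0 => h; rewrite (perm_mem perm_ps) !inE h !orbT.
- by rewrite -(perm_uniq perm_fl).
- rewrite big_cons path_edges_cat -rev_rcons path_edges_rev ep eq.
  rewrite -(setD1K eF) -/F' eF' (perm_big _ perm_ps) /= !big_cons.
  by move: [set u; v] (path_edges p) => e ep1; rewrite [LHS]setUCA !setUA.
- by move=> x; rewrite -(perm_mem perm_fl).
Qed.

End Paths.

(** * The linear arboricity *)

Section Arboricity.
Variable G : sgraph.
Implicit Types (x y v : G).

Lemma edgesP e : reflect (exists x y, adj x y /\ e = [set x; y]) (e \in edges G).
Proof.
apply: (iffP imset2P) => [[x y _]|[x [y [xy ->]]]].
  by rewrite !inE => xy ->; exists x, y.
by exists x y; rewrite ?inE.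
Qed.

Lemma adj_neq x y : adj x y -> x != y.
Proof. by apply: contraTneq => ->; rewrite adj_irrefl. Qed.

Lemma link_edges x y : link (edges G) x y = adj x y.
Proof.
apply/andP/idP => [[xy /edgesP[u [v [uv /eqP]]]]|xy].
  rewrite eq_set2 => /orP[]/andP[/eqP-> /eqP->] //; by rewrite adj_sym.
by split; [exact: adj_neq|apply/edgesP; exists x, y].
Qed.

Lemma deg_edges v : deg (edges G) v <= max_degree G.
Proof.
rewrite /max_degree; apply: leq_trans (leq_bigmax v).
by apply/subset_leq_card/subsetP => u; rewrite !inE link_edges.
Qed.

Lemma max_degree_lt : 0 < #|G| -> max_degree G < #|G|.
Proof.
move=> G0; rewrite -(prednK G0) ltnS; apply/bigmax_leqP => v _.
rewrite -ltnS (prednK G0) -cardsT; apply: proper_card.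
by apply/properP; split; [exact: subsetT|exists v; rewrite !inE ?adj_irrefl].
Qed.

Lemma peel_sub (E E' : {set {set G}}) k : peel E k E' -> E' \subset E.
Proof. by elim=> // j F E1 _ IH _; apply: subset_trans (subsetDl _ _) IH. Qed.

Lemma linear_arboricity_peel k : peel (edges G) k set0 -> linear_arboricity G <= k.
Proof.
move=> pk; have [P [partP Pk lfP]] := peel_partition pk erefl.
apply: leq_trans Pk; rewrite /linear_arboricity; case: ex_minnP => m _; apply.
apply/asboolP; exists P; split=> //; split=> // F FP.
have [E1 lfF] := lfP F FP; apply: lforest_linear_forest lfF => e eF.
have : e \in edges G.
  by have /and3P[/eqP<- _ _] := partP; apply/bigcupP; exists F.
by case/edgesP => x [y [xy ->]]; exists x, y; rewrite adj_neq.
Qed.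

(** After [D./2] rounds the potential bounds all degrees by [M]; then [peel_rest] removes what is
    left in [2 * M] rounds. *)
Lemma linear_arboricity_log L m : 72 <= m -> 0 < #|G| -> #|G| <= 2 ^ L ->
  linear_arboricity G <= (max_degree G)./2 + 2 * (2 + m.+1 * L).
Proof.
move=> m72 G0 GL; set D := max_degree G; set k := D./2.
have kD : 2 * k <= D by have := odd_double_half D; rewrite -/k; lia.
have [E' pE' wE'] := peel_weight (edges G) m72 kD.
set M := 2 + m.+1 * L.
have m0 : 0 < m by apply: leq_trans m72.
have dE' v : deg E' v <= M.
  rewrite -(@leq_exp2l 2) //.
  have w1 : weight (edges G) <= #|G| * 2 ^ D.
    by rewrite -sum_nat_const; apply: leq_sum => x _; rewrite leq_exp2l // deg_edges.
  have w2 : 4 ^ k * 2 ^ deg E' v * 2 ^ m <= 2 * #|G| * 2 ^ D * (2 * #|G|) ^ m.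
    apply: leq_trans (leq_trans wE' _).
      apply: leq_mul; last by rewrite leq_exp2r // leq_addl.
      rewrite leq_mul2l; apply/orP; right; apply: leq_trans (leq_addr _ _).
      by rewrite /weight (bigD1 v) //= leq_addr.
    apply: leq_mul; first by lia.
    (* [D < #|G|] gives [D + 2 <= 2 * #|G|]. *)
    by rewrite leq_exp2r //; have := max_degree_lt G0; rewrite -/D; lia.
  have w3 : 2 ^ D <= 2 * 4 ^ k.
    rewrite -[4]/(2 ^ 2) -expnM -expnS leq_exp2l //.
    by have := odd_double_half D; rewrite -/k; lia.
  have w4 : #|G| ^ m.+1 <= 2 ^ (m.+1 * L) by rewrite mulnC expnM leq_exp2r.
  rewrite -(@leq_pmul2l (4 ^ k * 2 ^ m)) ?muln_gt0 ?expn_gt0 // mulnAC.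
  apply: leq_trans w2 _; rewrite expnMn /M expnD (_ : 2 ^ 2 = 4) //.
  apply: leq_trans (_ : 2 ^ m * (2 * 2 ^ D) * #|G| ^ m.+1 <= _).
    by rewrite expnS; lia.
  apply: leq_trans (_ : 2 ^ m * (2 * (2 * 4 ^ k)) * 2 ^ (m.+1 * L) <= _).
    by rewrite !leq_mul.
  by lia.
have [|E'' pE'' nE''] := @peel_rest _ _ k (2 * M) E' pE'.
  by move=> u v _; have := dE' u; have := dE' v; lia.
apply: linear_arboricity_peel; rewrite (_ : set0 = E'') //.
apply/esym/setP => e; rewrite [RHS]inE; apply/negP => eE.
have /edgesP[x [y [xy ee]]] := subsetP (peel_sub pE'') e eE.
by case/negP: (nE'' x y); rewrite /link (adj_neq xy) -ee.
Qed.

(** Treated apart: the logarithm vanishes, while [linear_arboricity_log] with [L = 0] only gives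
    4. *)
Lemma linear_arboricity1 : #|G| = 1 -> linear_arboricity G = 0.
Proof.
move=> G1; apply/eqP; rewrite -leqn0; apply: linear_arboricity_peel.
rewrite (_ : set0 = edges G); first exact: peel0.
apply/esym/setP => e; rewrite [RHS]inE; apply/negP => /edgesP[x [y [xy _]]].
have /card_le1_eqP : #|G| <= 1 by rewrite G1.
by move=> /(_ x y isT isT) xy'; move: xy; rewrite xy' adj_irrefl.
Qed.

End Arboricity.

(** * The bound with the natural logarithm *)

Import Order.TTheory GRing.Theory Num.Theory.
Local Open Scope ring_scope.

Theorem theorem1p2 (R : realType) :
  exists K : R, 0 < K /\
    forall (n : nat) (G : sgraph), (1 <= n)%N -> #|vertex G| = n ->
      (linear_arboricity G)%:R <= (max_degree G)%:R / 2 + K * ln (n%:R : R).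
Proof.
have ln2 : 0 < ln (2 : R) by rewrite ln_gt0 // ltr1n.
exists (300 / ln 2); split; first by rewrite divr_gt0.
move=> n G n1 Gn; have [n2|] := ltnP 1 n; last first.
  move=> n1'; have {n1 n1'}n1 : n = 1%N by apply/eqP; rewrite eqn_leq n1 n1'.
  rewrite linear_arboricity1 ?Gn // n1 ln1 mulr0 addr0 divr_ge0 //.
have /andP[lo hi] := up_log_bounds (isT : (1 < 2)%N) n2.
set L := up_log 2 n in lo hi.
have L0 : (0 < L)%N by rewrite lt0n; apply: contraTneq hi => ->; rewrite -ltnNge.
(* With [m = 72] the error is [4 + 146 * L], and [L >= 1]. *)
have la : (linear_arboricity G <= (max_degree G)./2 + 150 * L)%N.
  have := @linear_arboricity_log G L 72 (leqnn _); rewrite Gn => /(_ (ltnW n2) hi).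
  by lia.
have n0 : 0 < n%:R :> R by rewrite ltr0n (ltnW n2).
(* [2 ^ L.-1 < n], and the last factor two is absorbed by [n >= 2]. *)
have Lln : L%:R * ln 2 <= 2 * ln (n%:R : R).
  have h1 : ln 2 <= ln (n%:R : R) by rewrite ler_ln ?posrE ?ler_nat.
  have h2 : L.-1%:R * ln 2 <= ln (n%:R : R).
    rewrite mulr_natl -lnXn // ler_ln ?posrE ?exprn_gt0 //.
    by rewrite -natrX ler_nat ltnW.
  rewrite -(prednK L0) -natr1 mulrDl mul1r [leRHS]mulr_natl mulr2n.
  exact: lerD.
have Lln' : L%:R <= 2 * ln (n%:R : R) / ln 2 by rewrite ler_pdivlMr.
apply: le_trans (_ : ((max_degree G)./2 + 150 * L)%:R <= _); first by rewrite ler_nat.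
rewrite natrD natrM; apply: lerD.
  rewrite ler_pdivlMr // -natrM ler_nat muln2.
  by have := odd_double_half (max_degree G); lia.
apply: le_trans (_ : 150 * (2 * ln n%:R / ln 2) <= _); first by rewrite ler_wpM2l.
by rewrite mulrA mulrA -natrM mulrAC.
Qed.
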